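(* Let $\mathsf q\in\mathbb C^\times$ with $|\mathsf q|<1$, and let $$L=a_0(x)\sigma_{\mathsf q}^2-a_1(x)\sigma_{\mathsf q}+a_2(x)$$ be a second order $\mathsf q$-difference operator with polynomial coefficients $a_0,a_1,a_2\in\mathbb C[x]$ satisfying the standing assumptions in the context. Let $s\in\mathbb C^\times$ and $r\in\mathbb Z_{>0}$. Assume that $a_0(x)$ and $a_2(\mathsf q^{-r}x)$ have a simple zero at $x=s$, and that there are no other zeroes of $a_0(x)$ or $a_2(x)$ of the form $\mathsf q^{j}s$, $j\in\mathbb Z$ (i.e. among the points $\mathsf q^js$, $j\in\mathbb Z$, $a_0$ vanishes only at $s$ and $a_2$ vanishes only at $\mathsf q^{-r}s$). Then the singularities $x=s,\ \mathsf q^{-r}s$ of $L$ are apparent if and only if $\Delta_r(s)=0$, where $\Delta_r(x)$ is the $(r+1)\times(r+1)$ tridiagonal determinant $\Delta_r(x)=\det\big(m_{i,j}(x)\big)_{0\le i,j\le r}$ with $$m_{i,i}(x)=a_1(\mathsf q^{-i}x),\quad m_{i,i+1}(x)=a_2(\mathsf q^{-i}x),\quad m_{i,i-1}(x)=a_0(\mathsf q^{-i}x),$$ and $m_{i,j}(x)=0$ for $|i-j|>1$.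
   Context: $\sigma_{\mathsf q}$ is the shift operator $(\sigma_{\mathsf q}f)(x)=f(\mathsf qx)$. With $L$ one associates the first order system $Y(\mathsf qx)=A(x)Y(x)$, where $$A(x)=\begin{pmatrix} a_1(x)/a_0(x) & -a_2(x)/a_0(x)\\ 1&0\end{pmatrix}.$$ Standing assumptions: $A(x)\in GL_2(\mathbb C(x))$ is holomorphic at $x=0$ and $x=\infty$; $A_0=A(0)$ and $A_\infty=A(\infty)$ are invertible; and both are strongly non-resonant, meaning that the eigenvalues $\lambda_1,\lambda_2$ of the matrix satisfy $\lambda_i\notin\mathsf q^{\mathbb Z}\lambda_j$ for $i\ne j$. A matrix valued function is called regular at a point if it is holomorphic and invertible there. Let $S_\pm\subset\mathbb C^\times$ be the set of poles of $A(x)^{\pm1}$ in $\mathbb C^\times$; the points of $S_+\cup S_-$ are the (intermediate) singularities of $L$. A singularity $s\in S_+\cup S_-$ is called apparent if the product $A(\mathsf q^{N}x)A(\mathsf q^{N-1}x)\cdots A(\mathsf q^{-N'}x)$ is regular at $x=s$ for all sufficiently large $N,N'\in\mathbb Z_{\ge0}$. *)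

(* Defs.v *)
From HB Require Import structures.
From mathcomp Require Import all_boot all_order all_algebra.
From mathcomp Require Import reals.
From mathcomp Require Export complex.

Set Implicit Arguments.
Unset Strict Implicit.
Unset Printing Implicit Defensive.

Import Order.TTheory GRing.Theory Num.Theory.
Local Open Scope ring_scope.

(* The field K(x) of rational functions in one variable. *)
Notation ratfun K := {fraction {poly K}}.

Local Notation "p %:F" := (FracField.tofrac p).

Section RationalFunctions.
Variable K : fieldType.
Implicit Types (p d : {poly K}) (f g : ratfun K) (c v : K).

Definition const_ratfun c : ratfun K := c%:P%:F.

Definition poly_subst p g : ratfun K := (map_poly const_ratfun p).[g].

(* f(g(x)).  The representative of f chosen by repr is irrelevant as soon as g
   is not a constant, see ratfun_compE. *)
Definition ratfun_comp f g : ratfun K :=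
  poly_subst \n_(repr f) g / poly_subst \d_(repr f) g.

Lemma const_ratfun_is_zmod_morphism : zmod_morphism const_ratfun.
Proof. by move=> a b; rewrite /const_ratfun polyCB rmorphB. Qed.

Lemma const_ratfun_is_monoid_morphism : monoid_morphism const_ratfun.
Proof.
by split=> [|a b]; rewrite /const_ratfun ?rmorph1 // polyCM rmorphM.
Qed.

HB.instance Definition _ := GRing.isZmodMorphism.Build K (ratfun K)
  const_ratfun const_ratfun_is_zmod_morphism.
HB.instance Definition _ := GRing.isMonoidMorphism.Build K (ratfun K)
  const_ratfun const_ratfun_is_monoid_morphism.

Lemma ratfun_reprE f :
  f = (\n_(repr f))%:F / (\d_(repr f))%:F.
Proof.
have e : f = \pi_(FracField.type _)%qT (repr f) by rewrite reprK.
move: (repr f) e => x ->; have dn0 := denom_ratioP x.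
apply: (@mulIf _ (\d_x)%:F); first by rewrite tofrac_eq0.
rewrite mulfVK ?tofrac_eq0 // !piE; apply/eqP.
rewrite FracField.equivf_def /FracField.equivf /FracField.mulf.
by rewrite !numden_Ratio ?mulf_neq0 ?oner_neq0 // !mulr1 mulrC.
Qed.

Lemma ratfun_compE p d g : d != 0 ->
    (forall h : {poly K}, h != 0 -> poly_subst h g != 0) ->
  ratfun_comp (p%:F / d%:F) g
  = poly_subst p g / poly_subst d g.
Proof.
move=> dn0 gP; set f := p%:F / _; rewrite /ratfun_comp.
have d'n0 := denom_ratioP (repr f).
have: (\n_(repr f))%:F / (\d_(repr f))%:F = p%:F / d%:F
  by rewrite -ratfun_reprE.
move/eqP; rewrite eqr_div ?tofrac_eq0 // -!tofracM tofrac_eq => /eqP e.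
apply/eqP; rewrite eqr_div ?gP //; apply/eqP.
by rewrite /poly_subst -!hornerM -!rmorphM e.
Qed.

Definition ratfun_dilate c f : ratfun K :=
  ratfun_comp f ((c *: 'X)%:F).

Definition ratfun_recip f : ratfun K :=
  ratfun_comp f ('X%:F)^-1.

(* f is holomorphic at c and takes the value v there. *)
Definition ratfun_value f c v : Prop :=
  exists p d : {poly K}, [/\ f = p%:F / d%:F,
    d.[c] != 0 & v = p.[c] / d.[c]].

Lemma ratfun_value_uniq f c v w :
  ratfun_value f c v -> ratfun_value f c w -> v = w.
Proof.
move=> [p [d [-> dc ->]]] [p' [d' [/eqP + d'c ->]]].
have nz h : h.[c] != 0 -> h%:F != 0.
  by apply: contraNneq => /eqP; rewrite tofrac_eq0 => /eqP->; rewrite horner0.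
rewrite eqr_div ?nz // -!tofracM tofrac_eq => /eqP e.
by apply/eqP; rewrite eqr_div // -!hornerM e.
Qed.

End RationalFunctions.

Section RationalMatrices.
Variables (K : fieldType) (n : nat).
Implicit Types (A : 'M[ratfun K]_n) (B : 'M[K]_n) (c : K).

Definition mx_value A c B : Prop := forall i j, ratfun_value (A i j) c (B i j).

(* The value at infinity is that of A(1/x) at 0. *)
Definition mx_value_infty A B : Prop :=
  mx_value (map_mx (@ratfun_recip K) A) 0 B.

Definition holomorphic_at A c : Prop := exists B, mx_value A c B.

Definition regular_at A c : Prop := exists2 B, mx_value A c B & B \in unitmx.

Definition mx_dilate c A : 'M[ratfun K]_n := map_mx (ratfun_dilate c) A.

(* s lies in S_+ or S_-, i.e. is a nonzero pole of A or of its inverse. *)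
Definition singularity A s : Prop :=
  s != 0 /\ (~ holomorphic_at A s \/ ~ holomorphic_at (invmx A) s).

(* A(q^N x) A(q^(N-1) x) ... A(q^(-N') x), in this order. *)
Definition shifted_prod (q : K) A (N N' : nat) : 'M[ratfun K]_n :=
  \prod_(k < (N + N').+1) mx_dilate (q ^ (N%:Z - k%:Z)) A.

Definition apparent_singularity (q : K) A s : Prop :=
  singularity A s /\
  exists M : nat, forall N N' : nat, (M <= N)%N -> (M <= N')%N ->
    regular_at (shifted_prod q A N N') s.

(* The eigenvalues are listed with multiplicity, so a repeated eigenvalue
   is a resonance (take k = 0). *)
Definition strongly_nonresonant (q : K) B : Prop :=
  forall l : 'I_n -> K, char_poly B = \prod_i ('X - (l i)%:P) ->
  forall (i j : 'I_n) (k : int), i != j -> l i != q ^ k * l j.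

End RationalMatrices.

Section SecondOrder.
Variables (K : fieldType) (q : K) (a0 a1 a2 : {poly K}).

Definition qshift_poly (c : K) (p : {poly K}) : {poly K} := p \Po (c *: 'X).

Definition qdiff_op (f : ratfun K) : ratfun K :=
  a0%:F * ratfun_dilate q (ratfun_dilate q f)
  - a1%:F * ratfun_dilate q f + a2%:F * f.

(* The system Y(q x) = A(x) Y(x) for Y = (f(q x), f(x))^T, where
   a0(x) f(q^2 x) - a1(x) f(q x) + a2(x) f(x) = 0. *)
Definition system_mx : 'M[ratfun K]_2 :=
  \matrix_(i < 2, j < 2)
    if i == 0 then
      if j == 0 then a1%:F / a0%:F else - (a2%:F / a0%:F)
    else if j == 0 then 1 else 0.

Lemma system_mxE f : a0 != 0 ->
  let Y : 'cV_2 := \col_(i < 2) if i == 0 then ratfun_dilate q f else f in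
  qdiff_op f = 0 <-> map_mx (ratfun_dilate q) Y = system_mx *m Y.
Proof.
move=> a0n0 Y; have a0Fn0 : a0%:F != 0 by rewrite tofrac_eq0.
have E u v : a0%:F * (u / a0%:F * v) = u * v.
  by rewrite mulrA [a0%:F * _]mulrC divfK.
rewrite /qdiff_op; set g := ratfun_dilate q f; split=> [e | /matrixP/(_ 0 0)].
  apply/matrixP=> i j; rewrite !mxE !big_ord_recl big_ord0 !mxE /= addr0.
  case: (i == 0); last by rewrite mul1r mul0r addr0.
  apply: (mulfI a0Fn0); apply/eqP; rewrite -subr_eq0 -[X in _ == X]e; apply/eqP.
  by rewrite mulrDr mulNr mulrN opprD opprK addrA !E.
rewrite !mxE !big_ord_recl big_ord0 !mxE /= addr0 => ->.
rewrite mulrDr mulNr mulrN !E.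
by rewrite [X in X + _]addrAC subrr add0r addNr.
Qed.

Definition tridiag_det (r : nat) : {poly K} :=
  \det (\matrix_(i < r.+1, j < r.+1)
    if (j : nat) == i then qshift_poly (q ^- i) a1
    else if (j : nat) == i.+1 then qshift_poly (q ^- i) a2
    else if j.+1 == i then qshift_poly (q ^- i) a0
    else 0).

End SecondOrder.

(* Main.v *)
Require Import Defs.
From HB Require Import structures.
From mathcomp Require Import all_boot all_order all_algebra.
From mathcomp Require Import reals complex.
From mathcomp Require Import zify.
Import Order.TTheory GRing.Theory Num.Theory.
Local Open Scope ring_scope.

(* Write A(x) = P(x) / a0(x) with P polynomial, so that det P = a0 a2.  Along
   the orbit q^Z s, only P(s) and P(q^-r s) are singular, each with a simple
   zero of the determinant.  A product of shifts of A through both factors is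
   Q / d, where d has a simple zero and det Q a double zero at the point
   considered, so it is regular there if and only if Q vanishes, that is, if
   and only if P(s) P(q^-1 s) ... P(q^-r s) = 0.  Only the upper left entry of
   this product can be nonzero, since a0(s) = a2(q^-r s) = 0, and it satisfies
   the three-term recurrence of the tridiagonal determinant. *)

Local Notation "p %:F" := (FracField.tofrac p).

(** * Tridiagonal determinants and products of companion matrices *)

Definition tridiag_mx {R : nzRingType} (a b c : nat -> R) n : 'M[R]_n :=
  \matrix_(i < n, j < n)
    if (j : nat) == i then b i
    else if (j : nat) == i.+1 then c i
    else if j.+1 == i then a i
    else 0.

(** At the coefficients of the operator this is the numerator P = a0 A, free of denominators; its
    determinant is [a * c]. *)
Definition comp_mx {R : nzRingType} (a b c : R) : 'M[R]_2 :=
  \matrix_(i < 2, j < 2)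
    if i == 0 then if j == 0 then b else - c
    else if j == 0 then a else 0.

Section CompanionProducts.
Variable R : comNzRingType.
Implicit Types (a b c : nat -> R).

(** The three-term recurrence of continuants: expand along the last row, then expand the
    off-diagonal minor along its last column, whose only nonzero entry is [c n]. *)
Lemma det_tridiag_mxSS a b c n :
  \det (tridiag_mx a b c n.+2) =
  b n.+1 * \det (tridiag_mx a b c n.+1)
  - c n * a n.+1 * \det (tridiag_mx a b c n).
Proof.
have lt_bump m k : (k < m)%N -> bump m k = k by rewrite /bump ltnNge => /negPf->.
have bumpnn m : bump m m = m.+1 by rewrite /bump leqnn.
have sgn m : (-1) ^+ (m + m) = 1 :> R by rewrite addnn -mul2n exprM sqrrN !expr1n.
rewrite (expand_det_row _ ord_max) !big_ord_recr /= big1 ?add0r => [|i _]; last first.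
  rewrite !mxE /=; have lt_in := ltn_ord i.
  by do 3![case: eqP => [?|_]; first lia]; rewrite mul0r.
rewrite !mxE /= !eqxx ltn_eqF // ltn_eqF // addrC; congr (_ + _).
  rewrite /cofactor /= sgn mul1r; congr (_ * \det _).
  by apply/matrixP=> i j; rewrite !mxE /= !lt_bump.
rewrite /cofactor /= (expand_det_col _ ord_max) big_ord_recr /= big1 ?add0r => [|i _].
  rewrite !mxE /= bumpnn lt_bump // eqxx gtn_eqF // addSn exprS sgn mulr1.
  rewrite /cofactor /= sgn mul1r mulN1r mulrN mulrCA mulrA; congr (- (_ * \det _)).
  apply/matrixP=> i j; have lt_in := ltn_ord i; have lt_jn := ltn_ord j.
  by rewrite !mxE /= !lt_bump //; lia.
have lt_in := ltn_ord i; rewrite !mxE /= bumpnn lt_bump; last lia.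
by do 3![case: eqP => [?|_]; first lia]; rewrite mul0r.
Qed.

Lemma mulmx2E (M N : 'M[R]_2) i j :
  (M *m N) i j = M i 0 * N 0 j + M i 1 * N 1 j.
Proof.
rewrite mxE big_ord_recr big_ord1.
by congr (M i _ * N _ j + M i _ * N _ j); apply: val_inj.
Qed.

(** Multiplying on the right by the next factor sends the upper row (u, v) to (u b + v a, - u c), so
    the upper left entry obeys the recurrence of [det_tridiag_mxSS]. *)
Lemma prod_comp_mx_row0 a b c n :
  let M := \prod_(k < n.+1) comp_mx (a k) (b k) (c k) in
  M 0 0 = \det (tridiag_mx a b c n.+1) /\
  M 0 1 = - (c n * \det (tridiag_mx a b c n)).
Proof.
elim: n => [|n [IH0 IH1]] /=.
  by rewrite big_ord1 det_mx11 det_mx00 !mxE /= mulr1.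
rewrite big_ord_recr /= -[_ * comp_mx _ _ _]/(_ *m _) !mulmx2E IH0 IH1 !mxE /=.
rewrite mulr0 addr0 det_tridiag_mxSS; split.
  by rewrite [b _ * _]mulrC mulNr mulrAC.
by rewrite mulrN mulrC.
Qed.

Lemma prod_comp_mx_eq0 a b c n : a 0%N = 0 -> c n = 0 ->
  \prod_(k < n.+1) comp_mx (a k) (b k) (c k) = 0 <->
  \det (tridiag_mx a b c n.+1) = 0.
Proof.
move=> a0 cn; have [e0 e1] := prod_comp_mx_row0 a b c n.
split=> [M0 | D0]; first by rewrite -e0 M0 mxE.
(* The leftmost factor has lower row (a 0, 0) = 0, and this row times the remaining factors is the
   lower row of the product. *)
have row1 j : (\prod_(k < n.+1) comp_mx (a k) (b k) (c k)) 1 j = 0.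
  rewrite big_ord_recl mxE big1 // => k _; rewrite !mxE /= a0.
  by case: ifP; rewrite mul0r.
have ord2 (i : 'I_2) : i = 0 \/ i = 1.
  by case: i => [[|[|//]] ?]; [left | right]; apply: val_inj.
apply/matrixP=> i j; rewrite [RHS]mxE.
case: (ord2 i) => ->; rewrite ?row1 //.
by case: (ord2 j) => ->; rewrite ?e0 // e1 cn mul0r oppr0.
Qed.

Lemma det_comp_mx (a b c : R) : \det (comp_mx a b c) = a * c.
Proof.
rewrite (expand_det_row _ 0) big_ord_recr big_ord_recr big_ord0 /= add0r.
rewrite /cofactor !det_mx11 !mxE /= !mulr0 add0r.
by rewrite expr1 mulN1r mulrNN mulrC.
Qed.

Lemma map_comp_mx (S : nzRingType) (f : {rmorphism R -> S}) (a b c : R) :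
  map_mx f (comp_mx a b c) = comp_mx (f a) (f b) (f c).
Proof.
apply/matrixP=> i j; rewrite !mxE.
by do 2!case: ifP => _; rewrite ?rmorphN ?rmorph0.
Qed.

Lemma map_prod_comp_mx (S : comNzRingType) (f : {rmorphism R -> S})
    (I : Type) (l : seq I) (a b c : I -> R) :
  map_mx f (\prod_(k <- l) comp_mx (a k) (b k) (c k)) =
  \prod_(k <- l) comp_mx (f (a k)) (f (b k)) (f (c k)).
Proof.
elim: l => [|k l IH]; first by rewrite !big_nil map_mx1.
by rewrite !big_cons -IH -map_comp_mx; apply: map_mxM.
Qed.

Lemma det_prod_comp_mx (I : Type) (l : seq I) (a b c : I -> R) :
  \det (\prod_(k <- l) comp_mx (a k) (b k) (c k)) = \prod_(k <- l) (a k * c k).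
Proof.
elim: l => [|k l IH]; first by rewrite !big_nil det1.
by rewrite !big_cons -IH -(det_comp_mx (a k) (b k) (c k)); apply: det_mulmx.
Qed.

End CompanionProducts.

(** * Cancelling the invertible factors of a product over a field *)

Section InvertibleFactors.
Variable K : fieldType.
Implicit Types (a b c : nat -> K).

Lemma prod_comp_mx_unit n (a b c : 'I_n -> K) :
    (forall k, a k != 0) -> (forall k, c k != 0) ->
  \prod_(k < n) comp_mx (a k) (b k) (c k) \in unitmx.
Proof.
move=> an0 cn0; rewrite unitmxE det_prod_comp_mx unitfE.
by apply/prodf_neq0 => k _; rewrite mulf_neq0.
Qed.

(** Factors before position m or after position m + r have nonzero determinant [a k * c k] and
    cancel; [prod_comp_mx_eq0] handles the r + 1 factors left. *)
Lemma prod_comp_mx_window a b c m r n : (m + r < n)%N ->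
    (forall k, (a k == 0) = (k == m)) -> (forall k, (c k == 0) = (k == m + r)%N) ->
  \prod_(k < n) comp_mx (a k) (b k) (c k) = 0 <->
  \det (tridiag_mx (fun i => a (m + i)%N) (fun i => b (m + i)%N)
                   (fun i => c (m + i)%N) r.+1) = 0.
Proof.
move=> lt_mr_n am cm; rewrite -prod_comp_mx_eq0; last 2 first.
- by apply/eqP; rewrite am addn0.
- by apply/eqP; rewrite cm.
have -> : n = (m + (r.+1 + (n - (m + r.+1))))%N by lia.
rewrite 2!big_split_ord /=.
set U := \prod_(k < m) _; set V := \prod_(k < n - _) _; set M := \prod_(k < r.+1) _.
have U_unit : U \in unitmx.
  by apply: prod_comp_mx_unit => k; rewrite ?am ?cm; have := ltn_ord k; lia.
have V_unit : V \in unitmx.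
  by apply: prod_comp_mx_unit => k; rewrite ?am ?cm; lia.
rewrite -[U * _]/(U *m (M *m V)); split=> [UMV0 | ->]; last by rewrite mul0mx mulmx0.
by rewrite -(mulmxK V_unit M) -(mulKmx U_unit (M *m V)) UMV0 mulmx0 mul0mx.
Qed.

End InvertibleFactors.

(** * Multiplicities of zeros under dilation and product *)

Section Multiplicity.
Variable K : fieldType.
Implicit Types (p : {poly K}) (c x : K).

Lemma qshift_poly_eq0 c p : c != 0 -> (qshift_poly c p == 0) = (p == 0).
Proof. by move=> c0; rewrite comp_poly2_eq0 // size_scale // size_polyX. Qed.

Lemma horner_qshift_poly c p x : (qshift_poly c p).[x] = p.[c * x].
Proof. by rewrite horner_comp hornerZ hornerX. Qed.

(** The dilation turns the linear factor X - c x into c (X - x), and the cofactor stays nonzero at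
    the point. *)
Lemma mup_qshift_poly c p x : c != 0 -> p != 0 ->
  mup x (qshift_poly c p) = mup (c * x) p.
Proof.
move=> c0 p0.
have [m [g]] := multiplicity_XsubC p (c * x); rewrite p0 /= => gx ->.
rewrite mupMr // mup_XsubCX eqxx /qshift_poly rmorphM rmorphXn /=.
rewrite mupMr; last by rewrite /root horner_qshift_poly.
rewrite comp_polyB comp_polyX comp_polyC.
have -> : c *: 'X - (c * x)%:P = c%:P * ('X - x%:P).
  by rewrite mulrBr mul_polyC -polyCM.
rewrite exprMn -polyC_exp mupMr ?mup_XsubCX ?eqxx //.
by rewrite rootC expf_neq0.
Qed.

(** By this default value, a hypothesis [mup x p = 1] forces [p != 0]. *)
Lemma mup0 x : mup x (0 : {poly K}) = 0%N.
Proof.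
rewrite /mup; set i := (X in nat_of_ord X).
by move: (ltn_ord i); rewrite [in X in (_ < X)%N -> _]size_poly0; case: (nat_of_ord i).
Qed.

Lemma mup_prod (I : Type) (l : seq I) (F : I -> {poly K}) x :
  (forall i, F i != 0) ->
  mup x (\prod_(i <- l) F i) = (\sum_(i <- l) mup x (F i))%N.
Proof.
move=> F0; elim: l => [|i l IH]; first by rewrite !big_nil mupNroot // root1.
by rewrite !big_cons mupM ?IH // prodf_seq_neq0 (eq_all (a2 := predT)) ?all_predT.
Qed.

End Multiplicity.

(** * Regularity of a polynomial matrix divided by a scalar polynomial *)

Section Regularity.
Variable K : fieldType.
Implicit Types (p d : {poly K}) (c : K).

Lemma poly_subst_dilate c p : poly_subst p (c *: 'X)%:F = (qshift_poly c p)%:F.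
Proof.
rewrite /poly_subst /qshift_poly /comp_poly -horner_map /= -map_poly_comp.
by [].
Qed.

Lemma ratfun_dilateE c p d : c != 0 -> d != 0 ->
  ratfun_dilate c (p%:F / d%:F) = (qshift_poly c p)%:F / (qshift_poly c d)%:F.
Proof.
move=> c0 d0; rewrite /ratfun_dilate ratfun_compE ?poly_subst_dilate //.
by move=> h h0; rewrite poly_subst_dilate tofrac_eq0 qshift_poly_eq0.
Qed.

Lemma system_mx_comp (a0 a1 a2 : {poly K}) : a0 != 0 ->
  system_mx a0 a1 a2 =
  (a0%:F)^-1 *: map_mx (@FracField.tofrac _) (comp_mx a0 a1 a2).
Proof.
move=> a0n0; have a0Fn0 : a0%:F != 0 by rewrite tofrac_eq0.
rewrite map_comp_mx; apply/matrixP=> i j; rewrite !mxE.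
by do 2!case: ifP => _; rewrite ?mulrN ?mulVf ?mulr0 // mulrC.
Qed.

Lemma mx_dilate_frac n c d (P : 'M[{poly K}]_n) : c != 0 -> d != 0 ->
  mx_dilate c ((d%:F)^-1 *: map_mx (@FracField.tofrac _) P) =
  ((qshift_poly c d)%:F)^-1 *:
    map_mx (@FracField.tofrac _) (map_mx (qshift_poly c) P).
Proof.
move=> c0 d0; apply/matrixP=> i j; rewrite !mxE.
by rewrite mulrC ratfun_dilateE // mulrC.
Qed.

(** Holomorphy of Q / d forces Q to vanish where d does. Conversely, if Q = (X - c) Q', one factor X
    - c cancels against d, while det Q = (X - c)^2 det Q' absorbs the double zero and leaves Q'
    invertible at c. *)
Lemma regular_at_frac c d (Q : 'M[{poly K}]_2) :
    mup c d = 1%N -> mup c (\det Q) = 2%N ->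
  regular_at ((d%:F)^-1 *: map_mx (@FracField.tofrac _) Q) c <->
  map_mx (horner_eval c) Q = 0.
Proof.
move=> dc Qc.
have [m [d' + dE]] := multiplicity_XsubC d c.
have d0 : d != 0.
  by apply/eqP=> d0; move: dc; rewrite d0 mup0.
rewrite d0 /= => d'c.
have m1 : m = 1%N by rewrite -dc dE mupMr // mup_XsubCX eqxx.
rewrite {}m1 expr1 in dE.
have dF0 : d%:F != 0 by rewrite tofrac_eq0.
have XF0 : ('X - c%:P)%:F != 0 by rewrite tofrac_eq0 polyXsubC_eq0.
have d'F0 : d'%:F != 0.
  by rewrite tofrac_eq0; apply: contraNneq d'c => ->; rewrite root0.
split=> [[B BV _] | Q0].
  apply/matrixP=> i j; rewrite !mxE /= horner_evalE.
  have [p [g [pE gc _]]] := BV i j; rewrite !mxE mulrC in pE.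
  have gF0 : g%:F != 0.
    by rewrite tofrac_eq0; apply: contraNneq gc => ->; rewrite horner0.
  move/eqP: pE; rewrite (eqr_div _ _ dF0 gF0) -2!tofracM tofrac_eq => /eqP.
  (* Evaluating the cross-multiplied identity Q_ij g = p d at c, where d vanishes and g does not,
     gives Q_ij(c) = 0. *)
  move/(congr1 (fun p : {poly K} => p.[c])).
  rewrite dE !hornerM hornerXsubC subrr !mulr0 => /eqP.
  by rewrite mulf_eq0 (negPf gc) orbF => /eqP.
have QX i j : exists g, Q i j = g * ('X - c%:P).
  apply/factor_theorem/rootP; move/matrixP/(_ i j): Q0.
  by rewrite !mxE.
pose Q' := \matrix_(i, j) (Q i j %/ ('X - c%:P)).
have QEij i j : Q i j = ('X - c%:P) * Q' i j.
  by rewrite mxE mulrC divpK //; have [g ->] := QX i j; rewrite dvdp_mull.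
have QE : Q = ('X - c%:P) *: Q' by apply/matrixP=> i j; rewrite [RHS]mxE QEij.
(* Otherwise det Q = (X - c)^2 det Q' would have a zero of order at least three. *)
have detQ' : ~~ root (\det Q') c.
  apply/negP=> /factor_theorem [g gE].
  have Q'0 : \det Q' != 0.
    by apply/eqP => Q'0; move: Qc; rewrite QE detZ Q'0 mulr0 mup0.
  move: Qc; rewrite QE detZ mupM ?expf_neq0 ?polyXsubC_eq0 //.
  rewrite mup_XsubCX eqxx -[2%N in RHS]addn0 => /addnI.
  by move/eqP; rewrite -leqn0 leqNgt -XsubC_dvd // gE dvdp_mull.
exists ((d'.[c])^-1 *: map_mx (horner_eval c) Q').
  move=> i j; exists (Q' i j), d'; split; last 2 first.
  - exact: d'c.
  - by rewrite !mxE mulrC.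
  rewrite mxE mxE QEij dE 2!tofracM.
  by rewrite invfM -mulrA (mulKf XF0) mulrC.
rewrite unitmxE detZ det_map_mx unitfE mulf_neq0 ?expf_neq0 ?invr_eq0 //.
Qed.

Lemma map_qshift_comp_mx c (a0 a1 a2 : {poly K}) :
  map_mx (qshift_poly c) (comp_mx a0 a1 a2) =
  comp_mx (qshift_poly c a0) (qshift_poly c a1) (qshift_poly c a2).
Proof.
apply/matrixP=> i j; rewrite !mxE /qshift_poly.
by do 2!case: ifP => _; rewrite ?comp_poly0 // raddfN.
Qed.

Lemma shifted_prodE (q : K) (a0 a1 a2 : {poly K}) N N' : q != 0 -> a0 != 0 ->
  let sh k := qshift_poly (q ^ (N%:Z - k%:Z)) in
  shifted_prod q (system_mx a0 a1 a2) N N' =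
  ((\prod_(k < (N + N').+1) sh k a0)%:F)^-1 *:
    map_mx (@FracField.tofrac _)
      (\prod_(k < (N + N').+1) comp_mx (sh k a0) (sh k a1) (sh k a2)).
Proof.
move=> q0 a0n0 sh; rewrite /shifted_prod.
elim: (N + N').+1 => [|n IH].
  by rewrite !big_ord0 map_mx1 invr1 scale1r.
rewrite !big_ord_recr /= IH system_mx_comp // mx_dilate_frac ?expfz_neq0 //.
rewrite map_qshift_comp_mx.
set D := \prod_(k < n) _; set Q := \prod_(k < n) comp_mx _ _ _.
rewrite -[LHS]/(_ *m _) -[Q * _]/(Q *m _) map_mxM.
by rewrite -scalemxAl -scalemxAr scalerA tofracM invfM.
Qed.

End Regularity.

(** * Regularity of shifted products along the orbit of s *)

Section ApparentSingularity.
Variables (K : fieldType) (q s : K) (a0 a1 a2 : {poly K}) (r : nat).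
Hypotheses (q_neq0 : q != 0) (a0_neq0 : a0 != 0) (a2_neq0 : a2 != 0).
Hypotheses (a0_simple : mup s a0 = 1%N) (a2_simple : mup (q ^- r * s) a2 = 1%N).
Hypothesis a0_orbit : forall j : int, root a0 (q ^ j * s) = (j == 0).
Hypothesis a2_orbit : forall j : int, root a2 (q ^ j * s) = (j == - r%:Z).

Lemma horner_tridiag_det x :
  (tridiag_det q a0 a1 a2 r).[x] =
  \det (tridiag_mx (fun i => a0.[q ^- i * x]) (fun i => a1.[q ^- i * x])
                   (fun i => a2.[q ^- i * x]) r.+1).
Proof.
rewrite -horner_evalE -det_map_mx; congr (\det _); apply/matrixP=> i j.
rewrite !mxE /= horner_evalE.
by do 3?[case: ifP => _]; rewrite ?horner_qshift_poly ?horner0.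
Qed.

(** At q^e s the k-th factor reads p at q^(N - k + e) s, so only the index k = m contributes. *)
Lemma mup_prod_qshift (p : {poly K}) (j0 : int) (e N : int) n (m : nat) :
    p != 0 -> mup (q ^ j0 * s) p = 1%N ->
    (forall j : int, root p (q ^ j * s) = (j == j0)) ->
    N + e - m%:Z = j0 -> (m < n)%N ->
  mup (q ^ e * s) (\prod_(k < n) qshift_poly (q ^ (N - k%:Z)) p) = 1%N.
Proof.
move=> p0 p_simple p_orbit Nem lt_mn.
rewrite mup_prod => [|k]; last by rewrite qshift_poly_eq0 ?expfz_neq0.
have mupE (k : 'I_n) : mup (q ^ e * s) (qshift_poly (q ^ (N - k%:Z)) p) = (k == m :> nat).
  rewrite mup_qshift_poly ?expfz_neq0 // mulrA -expfzDr //.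
  case: (eqVneq (k : nat) m) => [-> | km].
    by rewrite (_ : N - m%:Z + e = j0) ?p_simple //; lia.
  by rewrite mupNroot // p_orbit; lia.
rewrite (bigD1 (Ordinal lt_mn)) // mupE /= eqxx big1 // => k.
by rewrite mupE -val_eqE /= => /negPf->.
Qed.

(** Position m = N + e is the factor evaluated at s, where a0 vanishes; a2 vanishes at position m +
    r. The bound keeps both inside the product, so [regular_at_frac] and then [prod_comp_mx_window]
    apply. *)
Lemma regular_shifted_prod (e : int) (N N' m : nat) :
    N%:Z + e = m%:Z -> (m + r < (N + N').+1)%N ->
  regular_at (shifted_prod q (system_mx a0 a1 a2) N N') (q ^ e * s) <->
  (tridiag_det q a0 a1 a2 r).[s] = 0.
Proof.
move=> Nem lt_mr; rewrite shifted_prodE //.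
have a0_mup1 : mup (q ^ e * s)
    (\prod_(k < (N + N').+1) qshift_poly (q ^ (N%:Z - k%:Z)) a0) = 1%N.
  by apply: (@mup_prod_qshift a0 0 _ _ _ m); rewrite ?expr0z ?mul1r //; lia.
have a2_mup1 : mup (q ^ e * s)
    (\prod_(k < (N + N').+1) qshift_poly (q ^ (N%:Z - k%:Z)) a2) = 1%N.
  by apply: (@mup_prod_qshift a2 (- r%:Z) _ _ _ (m + r)); rewrite -?exprnN //; lia.
rewrite regular_at_frac; last 2 first.
- exact: a0_mup1.
- rewrite det_prod_comp_mx big_split /= mupM.
  + by rewrite a0_mup1 a2_mup1.
  + by apply/prodf_neq0 => k _; rewrite qshift_poly_eq0 ?expfz_neq0.
  + by apply/prodf_neq0 => k _; rewrite qshift_poly_eq0 ?expfz_neq0.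
have hE (p : {poly K}) (k : nat) :
    horner_eval (q ^ e * s) (qshift_poly (q ^ (N%:Z - k%:Z)) p)
    = p.[q ^ (m%:Z - k%:Z) * s].
  rewrite horner_evalE horner_qshift_poly mulrA -expfzDr //.
  by congr (_.[q ^ _ * _]); lia.
rewrite map_prod_comp_mx; under eq_bigr do rewrite /= !hE.
rewrite (@prod_comp_mx_window _ (fun k => a0.[q ^ (m%:Z - k%:Z) * s])
  (fun k => a1.[q ^ (m%:Z - k%:Z) * s]) (fun k => a2.[q ^ (m%:Z - k%:Z) * s]) m r) //.
- rewrite horner_tridiag_det; suff -> : tridiag_mx
    (fun i => a0.[q ^ (m%:Z - (m + i)%:Z) * s]) (fun i => a1.[q ^ (m%:Z - (m + i)%:Z) * s])
    (fun i => a2.[q ^ (m%:Z - (m + i)%:Z) * s]) r.+1 = tridiag_mx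
    (fun i => a0.[q ^- i * s]) (fun i => a1.[q ^- i * s]) (fun i => a2.[q ^- i * s]) r.+1 by [].
  have qE (i : nat) : q ^ (m%:Z - (m + i)%:Z) = q ^- i.
    by rewrite exprnN; congr (_ ^ _); lia.
  by apply/matrixP=> i j; rewrite !mxE !qE.
- by move=> k; rewrite -[_ == 0]/(root a0 _) a0_orbit; lia.
- by move=> k; rewrite -[_ == 0]/(root a2 _) a2_orbit; lia.
Qed.

(** The criterion of [regular_shifted_prod] does not depend on N and N', so one large pair decides
    for all. The cases e = 0 and e = -r are the two singularities. *)
Lemma apparent_shifted_prod (e : int) : (- r%:Z <= e <= 0)%R ->
  (exists M : nat, forall N N' : nat, (M <= N)%N -> (M <= N')%N ->
     regular_at (shifted_prod q (system_mx a0 a1 a2) N N') (q ^ e * s)) <->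
  (tridiag_det q a0 a1 a2 r).[s] = 0.
Proof.
move=> er; split=> [[M MP] | D0].
  (* Adding r to the threshold ensures that both singular factors occur in the product. *)
  by rewrite -(@regular_shifted_prod e (M + r) (M + r) `|((M + r)%:Z + e)%R|%N);
    try lia; apply: MP; lia.
(* From N, N' >= r and -r <= e <= 0 follow 0 <= N + e and N + e + r <= N + N'. *)
exists r => N N' rN rN'.
by rewrite (@regular_shifted_prod e N N' `|(N%:Z + e)%R|%N) //; lia.
Qed.

End ApparentSingularity.

(** * Poles of the system matrix and of its inverse *)

Section Singularities.
Variable K : fieldType.

Lemma ratfun_not_holomorphic (p d : {poly K}) (x : K) : d != 0 -> root d x -> ~~ root p x ->
  forall v, ~ ratfun_value (p%:F / d%:F) x v.
Proof.
move=> d0 /eqP dx px v [p' [d' [/eqP + d'x _]]].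
have dF0 : d%:F != 0 by rewrite tofrac_eq0.
have d'F0 : d'%:F != 0.
  by rewrite tofrac_eq0; apply: contraNneq d'x => ->; rewrite horner0.
rewrite (eqr_div _ _ dF0 d'F0) -2!tofracM tofrac_eq => /eqP.
move/(congr1 (fun p : {poly K} => p.[x])); rewrite !hornerM dx mulr0 => /eqP.
by rewrite mulf_eq0 (negPf d'x) orbF; apply/negP.
Qed.

Lemma singularity_root0 (a0 a1 a2 : {poly K}) (x : K) : a0 != 0 -> x != 0 ->
  root a0 x -> ~~ root a2 x -> singularity (system_mx a0 a1 a2) x.
Proof.
(* The pole is in the upper right entry - a2 / a0. *)
move=> a0n0 x0 a0x a2x; split=> //; left=> -[B /(_ 0 1)].
rewrite mxE /= -mulNr -tofracN.
by apply: ratfun_not_holomorphic; rewrite ?rootN.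
Qed.

Lemma singularity_root2 (a0 a1 a2 : {poly K}) (x : K) : system_mx a0 a1 a2 \in unitmx ->
  a0 != 0 -> a2 != 0 -> x != 0 -> root a2 x -> ~~ root a0 x ->
  singularity (system_mx a0 a1 a2) x.
Proof.
move=> A_unit a0n0 a2n0 x0 a2x a0x; split=> //; right=> -[B /(_ 1 0)].
have a0F0 : a0%:F != 0 by rewrite tofrac_eq0.
have a2F0 : a2%:F != 0 by rewrite tofrac_eq0.
suff -> : invmx (system_mx a0 a1 a2) 1 0 = (- a0)%:F / a2%:F.
  by apply: ratfun_not_holomorphic; rewrite ?rootN.
set B' := invmx _; have /matrixP AB1 := mulmxV A_unit.
(* Lower row (1, 0) of A: the upper left entry of the inverse is 0. The upper row of A then gives -
   (a2 / a0) times the lower left entry equal to 1. *)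
have := AB1 1 0; rewrite mulmx2E !mxE /= mul1r mul0r addr0 => B00.
have := AB1 0 0; rewrite mulmx2E !mxE /= B00 mulr0 add0r -/B' => B10.
apply: (mulfI a2F0); rewrite mulrCA mulfV // mulr1 tofracN.
apply: (mulfI (invr_neq0 a0F0)).
rewrite mulrA [_^-1 * _]mulrC mulrN (mulVf a0F0).
by apply: oppr_inj; rewrite opprK -mulNr.
Qed.

End Singularities.

(** Positive powers of q have norm below 1. Hence q is no root of unity, and the points q^j s are
    pairwise distinct. *)
Lemma expfz_eq1_norm_lt1 (R : numFieldType) (q : R) (j : int) :
  `|q| < 1 -> (q ^ j == 1) = (j == 0).
Proof.
move=> q1; have expq n : (q ^+ n == 1) = (n == 0%N).
  apply/eqP/eqP=> [/(congr1 Num.norm) | ->]; last exact: expr0.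
  rewrite normr1 normrX => qn1; apply/eqP.
  by rewrite -[_ == _]negbK -(exprn_ilt1 n (normr_ge0 q) q1) qn1 ltxx.
by case: j => n; rewrite ?NegzE -?exprnN ?invr_eq1 expq; lia.
Qed.

Theorem proposition2p3 (R : realType) (q : R[i])
    (hq0 : q != 0) (hq1 : `|q| < 1)
    (a0 a1 a2 : {poly R[i]})
    (hA : system_mx a0 a1 a2 \in unitmx)
    (A0 Ainf : 'M[R[i]]_2)
    (hA0 : mx_value (system_mx a0 a1 a2) 0 A0)
    (hAinf : mx_value_infty (system_mx a0 a1 a2) Ainf)
    (hA0_unit : A0 \in unitmx) (hAinf_unit : Ainf \in unitmx)
    (hA0_nonres : strongly_nonresonant q A0)
    (hAinf_nonres : strongly_nonresonant q Ainf)
    (s : R[i]) (hs : s != 0) (r : nat) (hr : (0 < r)%N)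
    (ha0_simple : mup s a0 = 1%N)
    (ha2_simple : mup s (qshift_poly (q ^- r) a2) = 1%N)
    (ha0_only : forall j : int, root a0 (q ^ j * s) -> q ^ j * s = s)
    (ha2_only : forall j : int, root a2 (q ^ j * s) -> q ^ j * s = q ^- r * s) :
  (apparent_singularity q (system_mx a0 a1 a2) s /\
   apparent_singularity q (system_mx a0 a1 a2) (q ^- r * s))
  <-> (tridiag_det q a0 a1 a2 r).[s] = 0.
Proof.
have qVr0 : q ^- r != 0 by rewrite invr_neq0 // expf_neq0.
have a00 : a0 != 0 by apply/eqP=> a00; move: ha0_simple; rewrite a00 mup0.
have a20 : a2 != 0.
  by apply/eqP=> a20; move: ha2_simple; rewrite a20 /qshift_poly comp_poly0 mup0.
rewrite mup_qshift_poly // in ha2_simple.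
have mup1_root (p : {poly R[i]}) x : mup x p = 1%N -> root p x.
  by move=> px; apply: contraT => /mupNroot; rewrite px.
have q_inj (j k : int) : q ^ j * s = q ^ k * s -> j = k.
  move/(mulIf hs) => qjk; apply/eqP; rewrite -subr_eq0.
  by rewrite -(expfz_eq1_norm_lt1 _ _ _ hq1) expfzDr // qjk -expfzDr // subrr expr0z.
(* Distinctness of the orbit points turns the hypotheses on points into conditions on exponents. *)
have a0_orbit (j : int) : root a0 (q ^ j * s) = (j == 0).
  apply/idP/eqP=> [/ha0_only | ->]; last by rewrite expr0z mul1r mup1_root.
  by rewrite -[X in _ = X -> _]mul1r -(expr0z q) => /q_inj.
have a2_orbit (j : int) : root a2 (q ^ j * s) = (j == - r%:Z).
  apply/idP/eqP=> [/ha2_only | ->]; last by rewrite -exprnN mup1_root.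
  by rewrite exprnN => /q_inj.
have s0 : s = q ^ (0 : int) * s by rewrite expr0z mul1r.
have sr : q ^- r * s = q ^ (- r%:Z) * s by rewrite exprnN.
have sing0 : singularity (system_mx a0 a1 a2) s.
  apply: singularity_root0 => //; first exact: mup1_root.
  (* Since r > 0, a2 does not vanish at s, so the pole of a2 / a0 there does not cancel. *)
  by rewrite s0 a2_orbit; lia.
have singr : singularity (system_mx a0 a1 a2) (q ^- r * s).
  apply: singularity_root2; rewrite ?mulf_neq0 //; first exact: mup1_root.
  by rewrite sr a0_orbit; lia.
have app e := @apparent_shifted_prod _ q s a0 a1 a2 r hq0 a00 a20 ha0_simple
  ha2_simple a0_orbit a2_orbit e.
have app0 := app 0 ltac:(lia); rewrite expr0z mul1r in app0.
have appr := app (- r%:Z) ltac:(lia); rewrite -exprnN in appr.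
split=> [[[_ /app0]] // | D0].
by split; split=> //; [apply/app0 | apply/appr].
Qed.
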